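(* For any $m\ge2$, the Abel series $c_{A,m}\in\mathbb{R}\langle\langle X\rangle\rangle$, $X=\{x_1,\ldots,x_m\}$, satisfies $$c_{A,m}=1+c_{A,m}\sqcup\!\sqcup\left(\sum_{i=1}^m x_i\,c_{A,m}^{\sqcup\!\sqcup\, i-1}\right).$$
   Context: $\mathbb{R}\langle\langle X\rangle\rangle$ is the set of real formal power series in the noncommuting letters $x_1,\ldots,x_m$; $1$ denotes the series consisting of the empty word $\mathrm{e}$ with coefficient $1$. The shuffle product $\sqcup\!\sqcup$ is the bilinear (continuous) product determined on words by $(x_i\eta)\sqcup\!\sqcup(x_j\xi)=x_i(\eta\sqcup\!\sqcup(x_j\xi))+x_j((x_i\eta)\sqcup\!\sqcup\xi)$ and $\eta\sqcup\!\sqcup\mathrm{e}=\mathrm{e}\sqcup\!\sqcup\eta=\eta$; $c^{\sqcup\!\sqcup\,k}$ is the $k$-th shuffle power, with $c^{\sqcup\!\sqcup\,0}=1$. The expression $x_i\,c$ is concatenation of the letter $x_i$ on the left. The Abel series $c_{A,m}$ is the generating series of the solution of $\dot z=\sum_{i=1}^mv_iz^{i+1}$, $z(0)=1$, i.e. $z(t)=\sum_\eta\langle c_{A,m},\eta\rangle E_\eta[v](t)$ with $E_{\mathrm{e}}[v]=1$ and $E_{x_i\eta}[v](t)=\int_0^tv_i(\tau)E_\eta[v](\tau)\,d\tau$. Explicitly, $c_{A,m}=\sum_{n\ge1}c_{A,m}(n)$, where $c_{A,m}(n)=0$ for $n<1$, $c_{A,m}(1)=1$, and $c_{A,m}(n)=\sum_{i=1}^m(n-i)\,c_{A,m}(n-i)\,x_i$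 for $n\ge2$ (concatenation with $x_i$ on the right). *)

(* Defs.v *)
From mathcomp Require Import all_boot all_order all_algebra.
From mathcomp Require Import mathcomp_extra boolp classical_sets functions.
From mathcomp Require Import cardinality fsbigop reals.

Set Implicit Arguments.
Unset Strict Implicit.
Unset Printing Implicit Defensive.

Import Order.TTheory GRing.Theory Num.Theory.
Local Open Scope classical_set_scope.
Local Open Scope ring_scope.

(* The letter x_i, 1 <= i <= m, is the ordinal of value i - 1. *)
Definition word (m : nat) := seq 'I_m.

(* A series is its coefficient function.  Only the pointwise additive structure
   of this function type is used: its pointwise product, and the corresponding
   unit (the constant function 1), play no role. *)
Definition ncseries (R : realType) (m : nat) := word m -> R.

Section NcSeries.
Variables (R : realType) (m : nat).
Implicit Types (u v w : word m) (i j : 'I_m) (c d : ncseries R m) (n k : nat).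

Definition ncword u : ncseries R m := fun w => (w == u)%:R.

Definition nc1 : ncseries R m := ncword [::].

Definition lconcat i c : ncseries R m := fun w =>
  if w is j :: w' then (if j == i then c w' else 0) else 0.

(* j :: w' is the word rcons (belast j w') (last j w'). *)
Definition rconcat c i : ncseries R m := fun w =>
  if w is j :: w' then (if last j w' == i then c (belast j w') else 0) else 0.

Fixpoint shuffle_word u : word m -> ncseries R m :=
  fix shuffle_u v : ncseries R m :=
    match u, v with
    | [::], _ => ncword v
    | _, [::] => ncword u
    | i :: u', j :: v' =>
        lconcat i (shuffle_word u' v) + lconcat j (shuffle_u v')
    end.

(* For each w, only the finitely many pairs (u, v) with |u| + |v| = |w|
   contribute: see finite_shuffle_support. *)
Definition shuffle c d : ncseries R m := fun w =>
  \sum_(p \in [set: word m * word m]) c p.1 * d p.2 * shuffle_word p.1 p.2 w.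

Definition shuffle_exp c k : ncseries R m := iter k (shuffle c) nc1.

(* The homogeneous parts of the Abel series: c(n) = 0 for n < 1, c(1) = 1 and
   c(n) = sum_(1 <= i <= m) (n - i) c(n - i) x_i for n >= 2; see abel_partS.
   The argument k only bounds the recursion depth.  With i : 'I_m standing for
   x_(i+1), the index n - (i+1) is truncated at 0, where the value is 0. *)
Fixpoint abel_rec k n : ncseries R m :=
  match k, n with
  | k'.+1, 1 => nc1
  | k'.+1, _.+2 =>
      \sum_(i < m) rconcat (abel_rec k' (n - i.+1)) i *+ (n - i.+1)
  | _, _ => 0
  end.

Definition abel_part n : ncseries R m := abel_rec n n.

(* For each w, only n = 1 + (sum of the indices of the letters of w)
   contributes: see abel_part_homog. *)
Definition abel : ncseries R m := fun w =>
  \sum_(n \in [set n | (1 <= n)%N]) abel_part n w.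

Lemma rconcat_rcons c i w j :
  rconcat c i (rcons w j) = if j == i then c w else 0.
Proof. by case: w => [|a w] //=; rewrite last_rcons belast_rcons. Qed.

Lemma abel_part0 : abel_part 0 = 0. Proof. by []. Qed.

Lemma abel_part1 : abel_part 1 = nc1. Proof. by []. Qed.

Lemma abel_partS n : (2 <= n)%N ->
  abel_part n = \sum_(i < m) rconcat (abel_part (n - i.+1)) i *+ (n - i.+1).
Proof.
have rec_stable k1 : forall k2 n', (n' <= k1)%N -> (n' <= k2)%N ->
    abel_rec k1 n' = abel_rec k2 n'.
  elim: k1 => [|k1 IH] [|k2] [|[|n']] // lt1 lt2 /=.
  apply: eq_bigr => i _; congr (rconcat _ _ *+ _).
  by apply: IH; rewrite subSS (leq_trans (leq_subr _ _)).
case: n => [|[|n]] // _; rewrite {1}/abel_part /=.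
apply: eq_bigr => i _; congr (rconcat _ _ *+ _).
by apply: (rec_stable n.+1 (n.+2 - i.+1)%N); rewrite ?subSS ?leq_subr.
Qed.

Lemma shuffle_word_size u v w :
  shuffle_word u v w != 0 -> size w = (size u + size v)%N.
Proof.
have ncwordP u' w' : ncword u' w' != 0 -> w' = u'.
  by rewrite /ncword pnatr_eq0 eqb0 negbK => /eqP.
elim: u v w => [|i u IHu] v w.
  by case: v => [|j v] /= /ncwordP ->.
elim: v w => [|j v IHv] w /=; first by move/ncwordP ->; rewrite addn0.
have addE (f g : ncseries R m) : (f + g) w = f w + g w by [].
rewrite addE; case: w {addE} => [|a w] /=; first by rewrite addr0 eqxx.
have [->|nz1] := eqVneq (if a == i then shuffle_word u (j :: v) w else 0) 0.
  rewrite add0r; case: (a == j); last by rewrite eqxx.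
  by move=> /IHv -> /=; rewrite addnS.
by move: nz1; case: (a == i); rewrite ?eqxx // => /IHu ->.
Qed.

Lemma finite_shuffle_support w :
  finite_set [set p : word m * word m | shuffle_word p.1 p.2 w != 0].
Proof.
pose T := ((size w).+1.-bseq 'I_m * (size w).+1.-bseq 'I_m)%type.
apply: (@sub_finite_set _ _
  ((fun p : T => (p.1 : seq _, p.2 : seq _)) @` [set: T])); last first.
  exact/finite_image/finite_finset.
move=> [u v] /= /shuffle_word_size sw.
have su : (size u <= (size w).+1)%N by rewrite sw ltnW // ltnS leq_addr.
have sv : (size v <= (size w).+1)%N by rewrite sw ltnW // ltnS leq_addl.
by exists (Bseq su, Bseq sv).
Qed.

Lemma abel_part_homog n w :
  abel_part n w != 0 -> n = (\sum_(i <- w) i.+1).+1.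
Proof.
have sumE I (r : seq I) (f : I -> ncseries R m) w' :
    (\sum_(i <- r) f i) w' = \sum_(i <- r) f i w'.
  by elim: r => [|a r IH]; rewrite ?big_nil // !big_cons -IH.
have mulE (f : ncseries R m) k w' : (f *+ k) w' = f w' *+ k.
  by elim: k => [|k IH] //; rewrite !mulrS -IH.
elim/last_ind: w n => [|w j IH] [|[|n]]; rewrite ?abel_part0 ?abel_part1 ?eqxx //.
- by rewrite big_nil.
- rewrite abel_partS // sumE big1 ?eqxx // => i _.
  by rewrite mulE mul0rn.
- by rewrite /nc1 /ncword; case: w {IH} => [|? ?] /=; rewrite eqxx.
rewrite abel_partS // sumE (bigD1 j) //= big1 => [|i /negPf nij]; last first.
  by rewrite mulE rconcat_rcons eq_sym nij mul0rn.
rewrite addr0 mulE rconcat_rcons eqxx mulrn_eq0 negb_or => /andP[n0 /IH nE].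
rewrite big_rcons /= -addSn -nE subnK //.
by rewrite ltnW // -subn_gt0 lt0n.
Qed.

End NcSeries.

Arguments nc1 : clear implicits.
Arguments abel_part : clear implicits.
Arguments abel : clear implicits.

(* Main.v *)
Require Import Defs.
From mathcomp Require Import all_boot all_order all_algebra.
From mathcomp Require Import mathcomp_extra boolp classical_sets functions.
From mathcomp Require Import cardinality fsbigop reals.
From mathcomp Require Import ring.

Import Order.TTheory GRing.Theory Num.Theory.
Local Open Scope classical_set_scope.
Local Open Scope ring_scope.

(** Let [P_k] be the series with coefficient 1 on the empty word and
    [P_k(x_j w) = k P_(k+j)(w)].  The letter [x_j] on the left acts as a
    derivation of the shuffle product, so induction on words gives
    [P_k ⧢ P_l = P_(k+l)].  The defining recursion of the Abel series [c], in
    which letters are removed on the right, identifies [c] with [P_1], hence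
    the [k]-th shuffle power of [c] with [P_k].  With [T = sum_i x_i P_(i-1)],
    a further induction on words gives [P_(k+1) = P_k + P_(k+1) ⧢ T] for all
    [k]; the theorem is the case [k = 0]. *)

(** The unshuffle coproduct, dual to the shuffle product: pairs of complementary subwords, repeated
    according to multiplicity. *)
Fixpoint splits {T : Type} (w : seq T) : seq (seq T * seq T) :=
  if w is j :: w' then
    [seq (j :: p.1, p.2) | p <- splits w'] ++
    [seq (p.1, j :: p.2) | p <- splits w']
  else [:: ([::], [::])].

(** On a word with letter indices j1, ..., jn this is k (k + j1) ... (k + j1 + ... + j(n-1)). The
    ordinal [j] stands for the letter of index [j.+1]. *)
Fixpoint abel_coef {m : nat} (k : nat) (w : word m) : nat :=
  if w is j :: w' then (k * abel_coef (k + j.+1) w')%N else 1%N.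

Definition abel_power (R : realType) (m k : nat) : ncseries R m :=
  fun w => (abel_coef k w)%:R.

Lemma ncseries_sumE {R : realType} {m : nat} {I : Type} (r : seq I)
    (F : I -> ncseries R m) (w : word m) :
  (\sum_(i <- r) F i) w = \sum_(i <- r) F i w.
Proof. by elim: r => [|a r IH]; rewrite ?big_nil // !big_cons -IH. Qed.

Lemma ncseries_mulrnE {R : realType} {m : nat} (c : ncseries R m) (k : nat)
    (w : word m) :
  (c *+ k) w = c w *+ k.
Proof. by elim: k => [|k IH] //; rewrite !mulrS -IH. Qed.

Lemma fsbig_count_mem {R : realType} {T : choiceType} (f : T -> R) (s : seq T) :
  \sum_(p \in [set: T]) f p * (count_mem p s)%:R = \sum_(p <- s) f p.
Proof.
rewrite -(fsbig_widen [set` undup s]) //; last first.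
  move=> p /= [_ /negP]; rewrite mem_undup => ps.
  by rewrite (count_memPn ps) mulr0.
rewrite -fsbig_seq ?undup_uniq //.
rewrite -[RHS]big_undup_iterop_count; apply: eq_bigr => p _.
by rewrite Monoid.iteropE mulr_natr; elim: count => //= n <-; rewrite mulrS.
Qed.

(** The first letter of [w] comes from the head of [u] or from the head of [v]; these are the two
    halves of [splits] and the two [lconcat] terms. *)
Lemma shuffle_word_count {R : realType} {m : nat} (u v w : word m) :
  shuffle_word R u v w = (count_mem (u, v) (splits w))%:R.
Proof.
elim: w u v => [|a w IH] u v; first by case: u v => [|i u] [|j v] //=; exact: addr0.
rewrite count_cat !count_map natrD.
(* A half of [splits] that puts a letter on an empty component of the target pair contributes
   nothing. *)
have nilE (f : seq 'I_m * seq 'I_m -> seq 'I_m * seq 'I_m) (p : word m * word m) :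
    (forall q, f q != p) -> count (preim f (pred1 p)) (splits w) = 0%N.
  by move=> fp; apply/eqP; rewrite -leqn0 leqNgt -has_count -all_predC;
    apply/allP => q _ /=.
have consE (f : seq 'I_m * seq 'I_m -> seq 'I_m * seq 'I_m)
    (p q : word m * word m) (b : bool) :
    (forall r, (f r == p) = b && (r == q)) ->
    (count (preim f (pred1 p)) (splits w))%:R =
      if b then shuffle_word R q.1 q.2 w else 0.
  case: q b => q1 q2 [] fp; first by rewrite IH; congr _%:R; apply: eq_count.
  by rewrite (eq_count (a2 := pred0)) ?count_pred0.
case: u v => [|i u] [|j v].
- by rewrite !nilE ?addr0 => [|q|q] //; rewrite xpair_eqE ?andbF.
- rewrite nilE ?add0r => [|[? ?]]; last by rewrite xpair_eqE.
  rewrite (consE _ _ ([::], v) (a == j)) => [|[? ?]]; last first.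
    by rewrite !xpair_eqE eqseq_cons andbCA.
  by case: v => [|k v]; rewrite /= /ncword eqseq_cons; case: (a == j).
- rewrite addrC nilE ?add0r => [|[? ?]]; last by rewrite xpair_eqE andbF.
  rewrite (consE _ _ (u, [::]) (a == i)) => [|[? ?]]; last first.
    by rewrite !xpair_eqE eqseq_cons andbA.
  by case: u => [|k u]; rewrite /= /ncword eqseq_cons; case: (a == i).
rewrite (consE _ _ (u, j :: v) (a == i)) => [|[? ?]]; last first.
  by rewrite !xpair_eqE eqseq_cons andbA.
rewrite (consE _ _ (i :: u, v) (a == j)) => [|[? ?]]; last first.
  by rewrite !xpair_eqE eqseq_cons andbCA.
by [].
Qed.

Lemma shuffleE {R : realType} {m : nat} (c d : ncseries R m) (w : word m) :
  shuffle c d w = \sum_(p <- splits w) c p.1 * d p.2.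
Proof.
rewrite -fsbig_count_mem; apply: eq_fsbigr => -[u v] _ /=.
by rewrite shuffle_word_count.
Qed.

Lemma shuffle_nil {R : realType} {m : nat} (c d : ncseries R m) :
  shuffle c d [::] = c [::] * d [::].
Proof. by rewrite shuffleE big_seq1. Qed.

(** The Leibniz rule for removing a letter on the left. *)
Lemma shuffle_cons {R : realType} {m : nat} (c d : ncseries R m) (j : 'I_m)
    (w : word m) :
  shuffle c d (j :: w) =
    shuffle (fun u => c (j :: u)) d w + shuffle c (fun v => d (j :: v)) w.
Proof. by rewrite !shuffleE big_cat !big_map. Qed.

Lemma shuffleZl {R : realType} {m : nat} (a : R) (c d : ncseries R m)
    (w : word m) :
  shuffle (fun u => a * c u) d w = a * shuffle c d w.
Proof.
by rewrite !shuffleE mulr_sumr; apply: eq_bigr => p _; rewrite mulrA.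
Qed.

Lemma shuffleZr {R : realType} {m : nat} (a : R) (c d : ncseries R m)
    (w : word m) :
  shuffle c (fun v => a * d v) w = a * shuffle c d w.
Proof.
by rewrite !shuffleE mulr_sumr; apply: eq_bigr => p _; rewrite mulrCA.
Qed.

Lemma abel_power_cons {R : realType} {m : nat} (k : nat) (j : 'I_m) :
  (fun w => abel_power R m k (j :: w)) =
  (fun w => k%:R * abel_power R m (k + j.+1) w).
Proof. by apply: funext => w; rewrite /abel_power /= natrM. Qed.

Lemma shuffle_abel_power {R : realType} {m : nat} (k l : nat) :
  shuffle (abel_power R m k) (abel_power R m l) = abel_power R m (k + l).
Proof.
apply: funext => w; elim: w k l => [|j w IH] k l.
  by rewrite shuffle_nil mulr1.
rewrite shuffle_cons !abel_power_cons shuffleZl shuffleZr !IH.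
(* Both Leibniz terms carry the same index k + l + j + 1, so their factors k and l add up. *)
rewrite [RHS](congr1 (fun f => f w) (abel_power_cons (k + l) j)).
by rewrite addnA [(k + _ + l)%N]addnAC natrD mulrDl.
Qed.

Lemma abel_power0 {R : realType} {m : nat} : abel_power R m 0 = nc1 R m.
Proof.
by apply: funext => -[|j w]; rewrite /abel_power /nc1 /ncword //= mul0n.
Qed.

(** This turns the recursion on the left into one on the right, the side on which the Abel series is
    defined. *)
Lemma abel_coef_rcons {m : nat} (k : nat) (w : word m) (j : 'I_m) :
  abel_coef k (rcons w j) = (abel_coef k w * (k + \sum_(i <- w) i.+1))%N.
Proof.
elim: w k => [|i w IH] k /=; first by rewrite big_nil addn0 mul1n muln1.
by rewrite IH big_cons addnA mulnA.
Qed.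

Lemma abel_part_deg {R : realType} {m : nat} (w : word m) :
  abel_part R m (\sum_(i <- w) i.+1).+1 w = abel_power R m 1 w.
Proof.
elim/last_ind: w => [|w j IH]; first by rewrite big_nil.
rewrite big_rcons /= abel_partS; last by rewrite addnC.
rewrite ncseries_sumE (bigD1 j) //= [X in _ + X]big1 ?addr0 => [|i /negPf nij];
  last first.
  by rewrite ncseries_mulrnE rconcat_rcons eq_sym nij mul0rn.
(* Only the summand of the last letter survives; its factor is 1 plus the weight of [w], as in
   [abel_coef_rcons] with k = 1. *)
rewrite ncseries_mulrnE rconcat_rcons eqxx.
rewrite -addSn addnK IH /abel_power abel_coef_rcons natrM mulr_natr.
by rewrite add1n.
Qed.

(** By homogeneity a single part of the Abel series is nonzero at a given word. *)
Lemma abelE (R : realType) (m : nat) : abel R m = abel_power R m 1.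
Proof.
apply: funext => w; rewrite -abel_part_deg /abel.
set n0 := (\sum_(i <- w) i.+1).+1.
transitivity (\sum_(n \in [set n0]) abel_part R m n w); last exact: fsbig_set1.
symmetry; apply: fsbig_widen => [n ->|n [_ nn0]] //=.
by apply: contra_notP nn0 => /eqP /abel_part_homog.
Qed.

Lemma shuffle_exp_abel {R : realType} {m : nat} (k : nat) :
  shuffle_exp (abel R m) k = abel_power R m k.
Proof.
rewrite abelE; elim: k => [|k IH]; first by rewrite abel_power0.
by rewrite /shuffle_exp iterS -/(shuffle_exp _ k) IH shuffle_abel_power.
Qed.

(** The index [k] stays general because removing a letter raises it. *)
Lemma abel_power_rec {R : realType} {m : nat} (T : ncseries R m) (k : nat) :
  T [::] = 0 ->
  (forall j : 'I_m, (fun w => T (j :: w)) = abel_power R m j) ->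
  abel_power R m k.+1 = abel_power R m k + shuffle (abel_power R m k.+1) T.
Proof.
move=> T0 TS; apply: funext => w.
have addE (f g : ncseries R m) u : (f + g) u = f u + g u by [].
elim: w k => [|j w IH] k; rewrite addE.
  by rewrite shuffle_nil T0 mulr0 addr0.
rewrite shuffle_cons TS shuffle_abel_power abel_power_cons shuffleZl.
rewrite ![abel_power _ _ _ (j :: w)]
  (congr1 (fun f => f w) (abel_power_cons _ j)).
(* The Leibniz term that differentiates [T] is P_(k+1+j)(w). It supplies the one copy missing
   between the factors k and k + 1. *)
move: (IH (k + j.+1)%N); rewrite addE -addSn => ->.
rewrite !addSnnS -natr1; ring.
Qed.

Theorem theorem4 (R : realType) (m : nat) (hm : (2 <= m)%N) :
  (* the ordinal i stands for the letter x_(i+1), whence the exponent i *)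
  abel R m =
    nc1 R m + shuffle (abel R m)
      (\sum_(i < m) lconcat i (shuffle_exp (abel R m) i)).
Proof.
under eq_bigr do rewrite shuffle_exp_abel.
(* The unit is P_0, which makes the goal the instance k = 0. *)
rewrite abelE -abel_power0; apply: abel_power_rec => [|j].
  by rewrite ncseries_sumE big1.
apply: funext => w; rewrite ncseries_sumE (bigD1 j) //= eqxx.
by rewrite big1 ?addr0 // => i /negPf nij; rewrite eq_sym nij.
Qed.
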